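(* There is a function $g(v,w,x,y,z):\mathbb{R}^{5}\rightarrow \mathbb{R}^{+}$ with the following property. Let $n,k$ be positive integers, let $(f_{i})_{i=1}^{k}$ be any frame for an $n$-dimensional Hilbert space $H_{n}$ with frame bounds $A, B$, such that $\alpha \le \|f_{i}\| \le \beta$ for all $1\le i \le k$, where $\alpha>0$, and let $0<\epsilon<1$. Then there is a subset $\sigma\subset\{1,2,\ldots,k\}$ with $|\sigma|\ge (1-\epsilon)n$ such that $(f_{i})_{i\in\sigma}$ is a Riesz basis for its span with Riesz basis constant $g(\epsilon, A, B, \alpha, \beta)$. (In particular, $g$ does not depend on $n$, $k$, $H_n$ or the frame.)
   Context: A family $(f_{i})_{i\in I}$ in a Hilbert space $H$ is a frame for $H$ with frame bounds $A,B$ ($0<A\le B<\infty$) if $A\|f\|^{2}\le \sum_{i\in I}|\langle f,f_{i}\rangle|^{2}\le B\|f\|^{2}$ for all $f\in H$. A family $(f_{i})_{i\in I}$ is a Riesz basis for its span with Riesz basis constant $M$ if $\frac{1}{M}\left(\sum_{i\in I}|a_{i}|^{2}\right)^{1/2}\le \left\|\sum_{i\in I}a_{i}f_{i}\right\|\le M\left(\sum_{i\in I}|a_{i}|^{2}\right)^{1/2}$ for every choice of scalars $(a_{i})_{i\in I}$. *)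

(* Defs.v *)
From HB Require Import structures.
From mathcomp Require Import all_boot all_order all_algebra.
From mathcomp Require Import complex.
From mathcomp Require Import reals.

Set Implicit Arguments.
Unset Strict Implicit.
Unset Printing Implicit Defensive.

Import Order.TTheory GRing.Theory Num.Theory.

Local Open Scope ring_scope.

(* A Hilbert space may be real or complex.  A finite-dimensional one is a
   vectType over the scalar field together with a form in {dot H for theta},
   theta being the conjugation of the scalars; completeness is automatic in
   finite dimension. *)
Variant scalars := RealScalars | ComplexScalars.

Definition scalar_field (R : realType) (F : scalars) : numFieldType :=
  match F with RealScalars => R | ComplexScalars => R[i] end.

Definition scalar_conj (R : realType) (F : scalars) :
    scalar_field R F -> scalar_field R F :=
  match F with RealScalars => idfun | ComplexScalars => @Num.conj R[i] end.

(* The norm of R[i] lives in R[i]; normc is the same modulus with values in R. *)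
Definition modulus (R : realType) (F : scalars) : scalar_field R F -> R :=
  match F with
  | RealScalars => fun x : R => `|x|
  | ComplexScalars => fun z : R[i] => ComplexField.Normc.normc z
  end.

Section Frames.
Variables (R : realType) (F : scalars) (H : vectType (scalar_field R F)).
Variable dot : {dot H for @scalar_conj R F}.

(* dot u u is a nonnegative real scalar, so modulus only moves it into R. *)
Definition hilbert_norm (u : H) : R := Num.sqrt (modulus (dot u u)).

Definition frame (I : finType) (f : I -> H) (A B : R) : Prop :=
  [/\ 0 < A, A <= B &
    forall u : H,
      A * hilbert_norm u ^+ 2 <= \sum_i modulus (dot u (f i)) ^+ 2
        <= B * hilbert_norm u ^+ 2].

Definition riesz_basis_for_span (I : finType) (s : {set I}) (f : I -> H)
    (M : R) : Prop :=
  forall a : I -> scalar_field R F,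
    M^-1 * Num.sqrt (\sum_(i in s) modulus (a i) ^+ 2)
      <= hilbert_norm (\sum_(i in s) a i *: f i)
      <= M * Num.sqrt (\sum_(i in s) modulus (a i) ^+ 2).

End Frames.

(* Main.v *)
Require Import Defs.
From HB Require Import structures.
From mathcomp Require Import all_boot all_order all_algebra.
From mathcomp Require Import complex ring lra.
From mathcomp Require Import reals.

(** Write S u for the sum of <u, f_i> f_i, the frame operator, and put
    g_i = S^-1 f_i.  The matrix P_ij = <g_i, f_j> is the Gram matrix of the f_i
    for the inner product <S^-1 u, v>.  For that inner product the frame is
    Parseval, so P is a Hermitian projection, of trace n
    ([dual_gram_adj], [dual_gram_idem], [trace_dual_gram]).  Two comparisons
    bring the problem down to P.  If w is a combination of the f_i with
    coefficients a, then A <S^-1 w, w> <= |w|^2, and <S^-1 w, w> is the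
    quadratic form of P at a ([dual_form_bound]); so a principal minor of P
    bounded below gives the lower Riesz inequality, while the upper one, with
    constant sqrt B, holds for every subfamily ([synthesis_bound]).  Moreover
    P_ii >= alpha^2 / B, so that k <= (B / alpha^2) n ([card_frame_le]).

    It remains to find, in a k x k projection P of trace n with k <= C n, a
    principal minor of size at least (1 - eps) n whose eigenvalues exceed a
    number depending on eps and C alone ([well_conditioned_minor]).  This is
    the restricted invertibility principle of Bourgain and Tzafriri, proved
    here by the barrier method of Spielman and Srivastava.  Let G be the minor
    selected so far, of size s, and b a barrier below its spectrum; the
    potential is tr (G - b)^-1.  Lowering the barrier decreases the potential
    ([trace_resolvent_shift]).  Adding an index j keeps the spectrum above the
    barrier b' exactly when the Schur complement
      p_j = P_jj - b' - c_j (G - b')^-1 c_j^H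
    is positive, c_j being the row of P at j restricted to the selected
    indices, and increases the potential by
    (1 + c_j (G - b')^-2 c_j^H) / p_j
    ([posdef_bordered], [trace_invmx_bordered]).  Because P is a projection
    the sums over all j of the numerators and of the p_j are explicit in s and
    in the traces of (G - b')^-1 and (G - b')^-2, so a comparison of the two
    sums yields a good j ([exists_good_extension]).

    For n larger than about 1 / eps^2 the barrier starts at eps / (4 C) and goes
    down by equal steps of order 1 / n; the quantity
    tr (G - b)^-1 - (n - s) / b stays at most its initial value, and after about
    (1 - eps) n steps the barrier is still at least a fixed multiple of eps^2 / C
    ([barrier_step], [barrier_extraction]).  For the remaining, boundedly many
    values of n, dividing the barrier by 3 at every step gives all n indices,
    with the lower bound 1 / (k 3^n) ([greedy_step], [greedy_extraction]). *)

Set Implicit Arguments.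
Unset Strict Implicit.
Unset Printing Implicit Defensive.

Import Order.TTheory GRing.Theory Num.Theory.

Local Open Scope ring_scope.

(** * Real and complex scalars *)
Section Scalars.
Variables (R : realType) (F : scalars).
Local Notation K := (scalar_field R F).
Local Notation conj := (@scalar_conj R F).

Fact scalar_conj_zmod : zmod_morphism conj.
Proof. by case: F => //= x y; exact: rmorphB. Qed.
Fact scalar_conj_monoid : monoid_morphism conj.
Proof. by case: F; split=> //=; [exact: rmorph1 | move=> x y; exact: rmorphM]. Qed.
Fact scalar_conjK : involutive conj.
Proof. by case: F => //= x; exact: conjCK. Qed.
HB.instance Definition _ :=
  GRing.isZmodMorphism.Build K K conj scalar_conj_zmod.
HB.instance Definition _ :=
  GRing.isMonoidMorphism.Build K K conj scalar_conj_monoid.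
HB.instance Definition _ := isInvolutive.Build K conj scalar_conjK.

(** Scalars are compared through their real parts, because the order is total on
    R only. *)
Definition real_scalar : R -> K :=
  match F return R -> scalar_field R F with
  | RealScalars => idfun | ComplexScalars => real_complex R end.

Definition real_part : K -> R :=
  match F return scalar_field R F -> R with
  | RealScalars => idfun | ComplexScalars => @complex.Re R end.

Fact real_scalar_zmod : zmod_morphism real_scalar.
Proof. by rewrite /real_scalar; case: F => //= x y; exact: rmorphB. Qed.
Fact real_scalar_monoid : monoid_morphism real_scalar.
Proof.
by rewrite /real_scalar; case: F; split=> //= x y; exact: rmorphM.
Qed.
HB.instance Definition _ :=
  GRing.isZmodMorphism.Build R K real_scalar real_scalar_zmod.
HB.instance Definition _ :=
  GRing.isMonoidMorphism.Build R K real_scalar real_scalar_monoid.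
Fact real_part_zmod : zmod_morphism real_part.
Proof. by rewrite /real_part; case: F => //= -[a b] [c d]. Qed.
HB.instance Definition _ :=
  GRing.isZmodMorphism.Build K R real_part real_part_zmod.

Lemma real_partZ r x : real_part (real_scalar r * x) = r * real_part x.
Proof.
by rewrite /real_part /real_scalar; case: F x => //= -[a b] /=; rewrite mul0r subr0.
Qed.

Lemma real_scalarK : cancel real_scalar real_part.
Proof. by rewrite /real_part /real_scalar; case: F. Qed.

Lemma real_partK x : 0 <= x -> real_scalar (real_part x) = x.
Proof.
rewrite /real_part /real_scalar; case: F x => //= -[a b].
by rewrite lecE /= => /andP[/eqP-> _].
Qed.

Lemma real_part_conj x : real_part (conj x) = real_part x.
Proof. by rewrite /real_part /scalar_conj; case: F x => //= -[]. Qed.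

Lemma conj_real_scalar r : conj (real_scalar r) = real_scalar r.
Proof. by rewrite /real_scalar /scalar_conj; case: F => //=; exact: conjc_real. Qed.

Lemma real_scalar_ge0 r : (0 <= real_scalar r) = (0 <= r).
Proof. by rewrite /real_scalar; case: F => //=; rewrite lecR. Qed.

Lemma real_scalar_gt0 r : (0 < real_scalar r) = (0 < r).
Proof. by rewrite /real_scalar; case: F => //=; rewrite ltcR. Qed.

Lemma mul_conj_ge0 x : 0 <= x * conj x.
Proof.
by rewrite /scalar_conj; case: F x => //= x; [exact: sqr_ge0|exact: mul_conjC_ge0].
Qed.

Lemma modulus_ge0 (x : K) : 0 <= modulus x.
Proof. by rewrite /modulus; case: F x => //= -[a b]; exact: sqrtr_ge0. Qed.

Lemma sqr_modulus (x : K) : modulus x ^+ 2 = real_part (x * conj x).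
Proof.
rewrite /modulus /scalar_conj /real_part; case: F x => /= x.
  by rewrite real_normK ?num_real.
case: x => a b /=.
by rewrite sqr_sqrtr ?addr_ge0 ?sqr_ge0 // mulrN opprK -!expr2.
Qed.

Lemma real_part_ge0 (x : K) : 0 <= x -> 0 <= real_part x.
Proof. by move=> x0; rewrite -real_scalar_ge0 real_partK. Qed.

Lemma real_part_nat m : real_part m%:R = m%:R.
Proof. by rewrite -[in LHS](rmorph_nat real_scalar) real_scalarK. Qed.

Lemma modulus_real (x : K) : 0 <= x -> modulus x = real_part x.
Proof.
move=> x0; apply/eqP; rewrite -(eqrXn2 (n:=2)) ?modulus_ge0 ?real_part_ge0 //.
rewrite sqr_modulus -{1 2}(real_partK x0) conj_real_scalar real_partZ.
by rewrite real_scalarK expr2.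
Qed.
End Scalars.

(** * The inverse of a bordered matrix *)
Section BorderedMatrix.
Variables (K : fieldType) (n : nat) (X : 'M[K]_n) (c : 'rV[K]_n) (e : 'cV[K]_n).
Variable d : K.
Local Notation Y := (invmx X).

(** [p] is the Schur complement of [X].  In this form the increase of the trace
    is a quotient whose numerator and denominator are both quadratic in the
    border, which is what makes averaging over the border possible. *)
Lemma trace_invmx_bordered (p := d - (c *m Y *m e) 0 0) :
  X \in unitmx -> p != 0 ->
  \tr (invmx (block_mx d%:M c e X)) = \tr Y + (1 + (c *m (Y *m Y) *m e) 0 0) / p.
Proof.
move=> uX p0; set Z := block_mx _ _ _ _.
have cYc : c *m Y *m e = (d - p)%:M.
  by rewrite [LHS]mx11_scalar /p opprB addrC subrK.
clearbody p.
(* The block form of the inverse, from elimination of the X block. *)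
pose W : 'M[K]_(1 + n) :=
  block_mx (p^-1)%:M (- p^-1 *: (c *m Y)) (- p^-1 *: (Y *m e))
           (Y + p^-1 *: (Y *m e *m c *m Y)).
have ZW : Z *m W = 1%:M.
  rewrite /Z /W mulmx_block scalar_mx_block; congr block_mx.
  - rewrite -scalemxAr mulmxA cYc -!scalar_mxM scale_scalar_mx -raddfD /=.
    by congr _%:M; field.
  - rewrite mulmxDr -!scalemxAr !mulmxA cYc !mul_scalar_mx.
    rewrite -!scalemxAl; apply/matrixP => i j; rewrite !mxE.
    by field.
  - by rewrite mul_mx_scalar -scalemxAr mulmxA (mulmxV uX) mul1mx
      -scalerDl subrr scale0r.
  - rewrite mulmxDr -!scalemxAr !mulmxA (mulmxV uX) mul1mx.
    by rewrite addrCA scaleNr addNr addr0.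
have [uZ _] := mulmx1_unit ZW.
have -> : invmx Z = W by rewrite -[LHS]mulmx1 -ZW mulKmx.
rewrite /W mxtrace_block mxtrace_scalar mulr1n mxtraceD mxtraceZ.
have -> : \tr (Y *m e *m c *m Y) = (c *m (Y *m Y) *m e) 0 0.
  rewrite -[RHS]mulr1n -mxtrace_scalar -mx11_scalar.
  by rewrite -mulmxA mxtrace_mulC !mulmxA mxtrace_mulC !mulmxA.
by rewrite addrCA [in RHS]mulrDl mul1r [in RHS](mulrC _ p^-1).
Qed.
End BorderedMatrix.

(** * Positive definite matrices *)
Section PositiveDefinite.
Variables (R : realType) (F : scalars).
Local Notation K := (scalar_field R F).
Local Notation conj := (@scalar_conj R F).
Local Notation "M ^H" := (map_mx conj M^T) (at level 8, format "M ^H").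
Local Notation "r %:K" := (@real_scalar R F r) (at level 2, format "r %:K").
Local Notation rpart := (@real_part R F).

Lemma adjmxM m n p (M : 'M[K]_(m, n)) (N : 'M[K]_(n, p)) :
  (M *m N)^H = N^H *m M^H.
Proof. by rewrite trmx_mul map_mxM. Qed.

Lemma adjmxK m n (M : 'M[K]_(m, n)) : (M^H)^H = M.
Proof. by apply/matrixP=> i j; rewrite !mxE rmorphK. Qed.

Lemma adjmxD m n (M N : 'M[K]_(m, n)) : (M + N)^H = M^H + N^H.
Proof. by rewrite linearD /= map_mxD. Qed.

Lemma adj_scalar_real n (r : R) : (r%:K%:M : 'M[K]_n)^H = r%:K%:M.
Proof. by rewrite tr_scalar_mx map_scalar_mx /= conj_real_scalar. Qed.

Lemma adj_invmx n (M : 'M[K]_n) : (invmx M)^H = invmx (M^H).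
Proof. by rewrite trmx_inv map_invmx. Qed.

Definition qform n (X : 'M[K]_n) (u : 'rV_n) : K := (u *m X *m u^H) 0 0.

Definition posdef n (X : 'M[K]_n) : Prop :=
  X^H = X /\ forall u : 'rV_n, u != 0 -> 0 < qform X u.

Lemma qform0 n (X : 'M[K]_n) : qform X 0 = 0.
Proof. by rewrite /qform !mul0mx mxE. Qed.

Lemma qform_ge0 n (X : 'M[K]_n) u : posdef X -> 0 <= qform X u.
Proof.
move=> [_ pX]; have [->|/pX/ltW//] := eqVneq u 0.
by rewrite qform0.
Qed.

Lemma qformD n (X Y : 'M[K]_n) u : qform (X + Y) u = qform X u + qform Y u.
Proof. by rewrite /qform mulmxDr mulmxDl mxE. Qed.

Lemma qform_scalar n (a : K) (u : 'rV_n) :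
  qform a%:M u = a * \sum_i u 0 i * conj (u 0 i).
Proof.
rewrite /qform mul_mx_scalar -scalemxAl mxE; congr (_ * _).
by rewrite mxE; apply: eq_bigr => i _; rewrite !mxE.
Qed.

Lemma posdefD_scalar n (X : 'M[K]_n) (r : R) :
  0 <= r -> posdef X -> posdef (X + r%:K%:M).
Proof.
move=> r0 [hX pX]; split; first by rewrite adjmxD hX adj_scalar_real.
move=> u /pX u0; rewrite qformD qform_scalar ltr_wpDr //.
rewrite mulr_ge0 ?real_scalar_ge0 // sumr_ge0 // => i _; exact: mul_conj_ge0.
Qed.

Lemma posdef_unit n (X : 'M[K]_n) : posdef X -> X \in unitmx.
Proof.
move=> [_ pX]; rewrite -row_free_unit -kermx_eq0; apply/eqP/row_matrixP => i.
rewrite row0; apply/eqP/negPn/negP => /pX.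
by rewrite /qform -row_mul mulmx_ker row0 mul0mx mxE ltxx.
Qed.

Lemma posdef_inv n (X : 'M[K]_n) : posdef X -> posdef (invmx X).
Proof.
move=> pX; have uX := posdef_unit pX; have [hX qX] := pX.
split=> [|u u0]; first by rewrite adj_invmx hX.
have -> : qform (invmx X) u = qform X (u *m invmx X).
  by rewrite /qform mulmxKV // adjmxM adj_invmx hX mulmxA.
by apply: qX; apply: contraNneq u0 => uY0; rewrite -[u](mulmxKV uX) uY0 mul0mx.
Qed.

(** The diagonal entries are values of the form of [X] at the rows of [M]. *)
Lemma trace_conj_ge0 m n (X : 'M[K]_n) (M : 'M_(m, n)) :
  posdef X -> 0 <= \tr (M *m X *m M^H).
Proof.
move=> pX; apply: sumr_ge0 => i _.
suff -> : (M *m X *m M^H) i i = qform X (row i M) by exact: qform_ge0.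
rewrite /qform -!row_mul !mxE; apply: eq_bigr => j _; rewrite !mxE.
by congr (_ * _); apply: eq_bigr => k _; rewrite !mxE.
Qed.

Lemma trace_mul_adj_ge0 m n (M : 'M[K]_(m, n)) : 0 <= \tr (M *m M^H).
Proof.
apply: sumr_ge0 => i _; rewrite mxE; apply: sumr_ge0 => j _.
by rewrite !mxE mul_conj_ge0.
Qed.

Section Schur.
Variables (n : nat) (X : 'M[K]_n) (c : 'rV[K]_n) (d : K).
Hypothesis pX : posdef X.
Local Notation Y := (invmx X).
Let p := d - qform Y c.
Hypothesis p_gt0 : 0 < p.
Let Z : 'M[K]_(1 + n) := block_mx d%:M c c^H X.

Let hX : X^H = X. Proof. by case: pX. Qed.
Let uX := posdef_unit pX.
Let hY : Y^H = Y. Proof. by rewrite adj_invmx hX. Qed.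

Let cYc : c *m Y *m c^H = (d - p)%:M.
Proof. by rewrite [LHS]mx11_scalar /p opprB addrC subrK. Qed.

(** Completing the square: at the vector (x, y) the form of [Z] is the form of
    [X] at y + x c Y, plus p |x|^2. *)
Lemma posdef_bordered : posdef Z.
Proof.
have hd : conj d = d.
  rewrite -[d](subrK (qform Y c)) rmorphD /= -/p.
  have qY := qform_ge0 c (posdef_inv pX).
  by rewrite -(real_partK (ltW p_gt0)) -(real_partK qY) !conj_real_scalar.
split.
  by rewrite /Z tr_block_mx map_block_mx hX adjmxK tr_scalar_mx map_scalar_mx /= hd.
move=> u; rewrite -[u]hsubmxK; move: (lsubmx u) (rsubmx u) => x y.
have -> : qform Z (row_mx x y) = qform X (y + x *m c *m Y) + p * (x 0 0 * conj (x 0 0)).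
  have -> : p * (x 0 0 * conj (x 0 0)) = (x *m p%:M *m x^H) 0 0.
    by rewrite mul_mx_scalar -scalemxAl !mxE big_ord1 !mxE.
  have -> : p%:M = d%:M - c *m Y *m c^H :> 'M_1.
    by rewrite cYc -raddfB /= opprB addrC subrK.
  rewrite /qform /Z mul_row_block tr_row_mx map_col_mx mul_row_col.
  rewrite (adjmxD y) adjmxM (adjmxM x c) hY.
  rewrite mulmxBr mulmxBl !mulmxDl !mulmxDr !mulmxA.
  rewrite (mulmxKV uX) (mulmxK uX) !mxE.
  by ring.
move=> u0; have [x0|x0] := eqVneq (x 0 0) 0.
  have x0' : x = 0 by rewrite [x]mx11_scalar x0 raddf0.
  rewrite x0 mul0r mulr0 addr0 x0' !mul0mx addr0; case: pX => _; apply.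
  by apply: contraNneq u0 => ->; rewrite x0' row_mx0.
apply: ltr_wpDl; first exact: qform_ge0.
by rewrite mulr_gt0 // lt0r mul_conj_ge0 mulf_neq0 // fmorph_eq0.
Qed.

End Schur.
End PositiveDefinite.

(** * Well conditioned principal minors of a projection *)
Section Barrier.
Variables (R : realType) (F : scalars).
Local Notation K := (scalar_field R F).
Local Notation conj := (@scalar_conj R F).
Local Notation "M ^H" := (map_mx conj M^T) (at level 8, format "M ^H").
Local Notation "r %:K" := (@real_scalar R F r) (at level 2, format "r %:K").
Local Notation rpart := (@real_part R F).

(** With Z = X^-1, the resolvent identity Z = Y + r Z Y, used twice, gives
    tr Z = tr Y + r tr Y^2 + r^2 tr (Y Z Y), whose last term is nonnegative.
    The gain r tr Y^2 pays for the second order term in the cost of adding an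
    index. *)
Lemma trace_resolvent_shift n (X : 'M[K]_n) (r : R) : posdef X -> 0 <= r ->
  let Y := invmx (X + r%:K%:M) in
  [/\ 0 <= rpart (\tr Y), 0 <= rpart (\tr (Y *m Y)) &
  rpart (\tr Y) + r * rpart (\tr (Y *m Y)) <= rpart (\tr (invmx X))].
Proof.
move=> pX r0 Y; have uX := posdef_unit pX.
have pX' := posdefD_scalar r0 pX; have uX' := posdef_unit pX'.
have pY : posdef Y := posdef_inv pX'; have hY : Y^H = Y by case: pY.
split.
- by have /real_part_ge0 := trace_conj_ge0 1%:M pY; rewrite mul1mx trmx1 map_mx1 mulmx1.
- by apply: real_part_ge0; rewrite -[in X in _ *m X]hY trace_mul_adj_ge0.
pose Z := invmx X.
have ZE : Z = Y + r%:K *: (Z *m Y).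
  rewrite -[LHS](mulmxK uX') -/Y mulmxDr (mulVmx uX) mulmxDl mul1mx.
  by rewrite mul_mx_scalar -scalemxAl.
have -> : \tr (invmx X) = \tr Y + r%:K * (\tr (Y *m Y) + r%:K * \tr (Y *m Z *m Y)).
  rewrite -/Z {1}ZE mxtraceD mxtraceZ; congr (_ + _ * _).
  rewrite mxtrace_mulC {1}ZE mulmxDr mxtraceD; congr (_ + _).
  by rewrite -scalemxAr mxtraceZ mulmxA.
rewrite raddfD /= real_partZ raddfD /= real_partZ lerD2l ler_wpM2l //.
rewrite lerDl mulr_ge0 //; apply: real_part_ge0.
by rewrite -[in X in _ *m X]hY; apply: trace_conj_ge0; exact: posdef_inv.
Qed.

Section Compression.
Variables (n k : nat) (P : 'M[K]_k).
Hypotheses (hP : P^H = P) (PP : P *m P = P) (trP : \tr P = n%:R).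

(** The selected indices are an enumeration [f] rather than a set, so that
    adding an index borders the matrix by one row and one column. *)
Definition shifted_gram s (f : 'I_s -> 'I_k) (b : R) : 'M[K]_s :=
  mxsub f f P - b%:K%:M.

(** The sum of 1 / (x - b) over the eigenvalues x of the selected minor: it
    blows up when an eigenvalue comes close to the barrier [b]. *)
Definition potential s (f : 'I_s -> 'I_k) (b : R) : R :=
  rpart (\tr (invmx (shifted_gram f b))).

Definition prepend s (j : 'I_k) (f : 'I_s -> 'I_k) (i : 'I_s.+1) : 'I_k :=
  match split (i : 'I_(1 + s)) with inl _ => j | inr a => f a end.

Lemma prepend_lshift s j (f : 'I_s -> 'I_k) (i : 'I_1) : prepend j f (lshift s i) = j.
Proof. by rewrite /prepend (unsplitK (inl i)). Qed.

Lemma prepend_rshift s j (f : 'I_s -> 'I_k) i : prepend j f (rshift 1 i) = f i.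
Proof. by rewrite /prepend (unsplitK (inr i)). Qed.

Lemma shifted_gram_prepend s j (f : 'I_s -> 'I_k) b :
  shifted_gram (prepend j f) b =
  block_mx (P j j - b%:K)%:M (colsub f (row j P)) (colsub f (row j P))^H
           (shifted_gram f b) :> 'M_(1 + s).
Proof.
rewrite -[LHS](@submxK _ 1 s 1 s); congr block_mx; apply/matrixP=> x y; rewrite !mxE.
- by rewrite !prepend_lshift !ord1.
- by rewrite prepend_lshift prepend_rshift -val_eqE /= ord1 subr0.
- by rewrite prepend_lshift prepend_rshift -val_eqE /= ord1 subr0 -{1}hP !mxE.
- by rewrite !prepend_rshift -val_eqE /= eqSS val_eqE.
Qed.

Lemma shifted_gramD s (f : 'I_s -> 'I_k) b b' :
  shifted_gram f b' = shifted_gram f b + (b - b')%:K%:M.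
Proof.
by apply/matrixP => x y; rewrite !mxE rmorphB mulrnBl addrA subrK.
Qed.

(** This is where P^2 = P enters: the Gram matrix of the columns of P at the
    selected indices is the selected minor itself. *)
Lemma sum_qform_rows s (f : 'I_s -> 'I_k) (Y : 'M[K]_s) :
  \sum_j qform Y (colsub f (row j P)) = \tr (Y *m mxsub f f P).
Proof.
rewrite -[in RHS]PP mxsub_mul mulmxA mxtrace_mulC mulmxA.
rewrite /mxtrace; apply: eq_bigr => j _; rewrite /qform.
have -> : colsub f (row j P) = row j (colsub f P).
  by apply/matrixP => x y; rewrite !mxE.
rewrite -row_mul mxE [RHS]mxE; apply: eq_bigr => i _.
by congr (_ * _); rewrite !mxE // -[in RHS]hP !mxE.
Qed.

Lemma trace_inv_gram s (f : 'I_s -> 'I_k) b :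
  posdef (shifted_gram f b) ->
  rpart (\tr (invmx (shifted_gram f b) *m mxsub f f P)) =
    s%:R + b * potential f b.
Proof.
move=> /posdef_unit uX; rewrite -[mxsub f f P](subrK b%:K%:M) mulmxDr mulVmx //.
by rewrite mul_mx_scalar mxtraceD mxtrace1 mxtraceZ raddfD /= real_partZ real_part_nat.
Qed.

Lemma trace_sqr_inv_gram s (f : 'I_s -> 'I_k) b (Y := invmx (shifted_gram f b)) :
  posdef (shifted_gram f b) ->
  rpart (\tr (Y *m Y *m mxsub f f P)) =
    potential f b + b * rpart (\tr (Y *m Y)).
Proof.
move=> /posdef_unit uX; rewrite -[mxsub f f P](subrK b%:K%:M) mulmxDr mulmxKV //.
by rewrite mul_mx_scalar mxtraceD mxtraceZ raddfD /= real_partZ.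
Qed.

(** Let p_j be the Schur complement of the index j and (1 + e_j) / p_j the
    increase of the potential that j causes.  The hypothesis says that the sum
    over all j of D p_j - 1 - e_j is nonnegative, so one term is; for such a j,
    p_j > 0 and the increase is at most D.  Summing over all indices, the
    selected ones included, is harmless: for these p_j <= 0 when b >= 0, and
    they are not the index found. *)
Lemma exists_good_extension s (f : 'I_s -> 'I_k) (b D : R)
    (Y := invmx (shifted_gram f b)) :
  (0 < k)%N -> 0 < D -> posdef (shifted_gram f b) ->
  k%:R + potential f b + b * rpart (\tr (Y *m Y))
    <= D * (n%:R - s%:R - k%:R * b - b * potential f b) ->
  exists j, posdef (shifted_gram (prepend j f) b) /\
            potential (prepend j f) b <= potential f b + D.
Proof.
move=> k0 D0 pX leD; have pY : posdef Y := posdef_inv pX.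
have hY : Y^H = Y by case: pY.
pose c j := colsub f (row j P).
pose p j := rpart (P j j) - b - rpart (qform Y (c j)).
pose e j := rpart (qform (Y *m Y) (c j)).
have Pjj_ge0 j : 0 <= P j j.
  rewrite -PP -[in X in _ *m X]hP mxE; apply: sumr_ge0 => i _.
  by rewrite !mxE mul_conj_ge0.
have e_ge0 j : 0 <= qform (Y *m Y) (c j).
  rewrite /qform -mulmxA -{2}hY -mulmxA -adjmxM mulmxA mxE.
  by apply: sumr_ge0 => i _; rewrite !mxE mul_conj_ge0.
have pE j : (p j)%:K = P j j - b%:K - qform Y (c j).
  by rewrite !rmorphB /= !real_partK // qform_ge0.
have [j ge0j] : exists j, 0 <= D * p j - 1 - e j.
  apply/existsP; apply: contraT => /existsPn lt0.
  suff : 0 <= \sum_j (D * p j - 1 - e j).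
    (* If all terms were negative, so would be their sum, as k > 0. *)
    rewrite leNgt => /negP[]; rewrite (bigD1 (Ordinal k0)) //= ltr_wnDr ?ltNge //.
    by apply: sumr_le0 => j _; rewrite leNgt; apply: contra (lt0 j) => /ltW.
  rewrite !sumrB -mulr_sumr sumr_const card_ord !sumrB sumr_const card_ord.
  rewrite -!raddf_sum /= !sum_qform_rows trace_inv_gram // trace_sqr_inv_gram //.
  rewrite -/(mxtrace P) trP real_part_nat.
  rewrite -(mulr_natl b) -/Y.
  by move: leD; lra.
have p_gt0 : 0 < p j.
  have : 0 < D * p j.
    by have := real_part_ge0 (e_ge0 j); rewrite -/(e j); move: ge0j; lra.
  by rewrite pmulr_rgt0.
have pK_gt0 : 0 < P j j - b%:K - qform Y (c j) by rewrite -pE real_scalar_gt0.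
exists j; split.
  by rewrite shifted_gram_prepend; exact: (posdef_bordered pX pK_gt0).
rewrite {1}/potential shifted_gram_prepend trace_invmx_bordered; first last.
- by rewrite gt_eqF.
- exact: posdef_unit.
rewrite raddfD /= lerD2l -/(qform (invmx _) _) -/Y -/(qform _ _) -/(c j) -pE.
rewrite -(real_partK (e_ge0 j)) -/(e j) -(rmorph1 (@real_scalar R F)) -rmorphD.
rewrite -fmorph_div real_scalarK ler_pdivrMr //.
by move: ge0j; lra.
Qed.

(** Both moves of the method in one statement: the barrier goes down from [b] to
    [b'], then an index is added.  The witness [q] is the trace of the squared
    resolvent at [b']; later arguments use only the stated inequalities. *)
Lemma lower_barrier s (f : 'I_s -> 'I_k) (b b' : R) :
  (0 < k)%N -> posdef (shifted_gram f b) -> b' <= b ->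
  exists q,
    [/\ 0 <= potential f b', 0 <= q,
        potential f b' + (b - b') * q <= potential f b &
        forall D, 0 < D ->
          k%:R + potential f b' + b' * q
            <= D * (n%:R - s%:R - k%:R * b' - b' * potential f b') ->
          exists f' : 'I_s.+1 -> 'I_k, posdef (shifted_gram f' b') /\
            potential f' b' <= potential f b' + D].
Proof.
move=> k0 pX le_b'b; set Y := invmx (shifted_gram f b').
have d0 : 0 <= b - b' by rewrite subr_ge0.
have [t0 q0 tq] := trace_resolvent_shift pX d0.
rewrite -shifted_gramD -/Y in t0 q0 tq.
exists (rpart (\tr (Y *m Y))); split=> // D D0 leD.
have pX' : posdef (shifted_gram f b').
  by rewrite (shifted_gramD f b); exact: posdefD_scalar.
by have [j] := exists_good_extension k0 D0 pX' leD; exists (prepend j f).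
Qed.

Lemma posdef_shifted_gram0 (f : 'I_0 -> 'I_k) b : posdef (shifted_gram f b).
Proof.
by split=> [|u /negP[]]; [rewrite [LHS]flatmx0 [RHS]flatmx0 | rewrite thinmx0].
Qed.

Lemma potential0 (f : 'I_0 -> 'I_k) b : potential f b = 0.
Proof. by rewrite /potential /mxtrace big_ord0 raddf0. Qed.

(** As long as fewer than n indices are selected, the sum of the Schur complements
    is at least 1 - b' (k + potential), hence at least 2 / 3 for b' = b / 3.  The
    invariant thus survives with both sides multiplied by 3; in the cost of
    the new index, D = 3 / (2 b). *)
Lemma greedy_step s (f : 'I_s -> 'I_k) (b : R) :
  (0 < k)%N -> (s < n)%N -> 0 < b -> posdef (shifted_gram f b) ->
  k%:R + potential f b <= b^-1 ->
  exists f' : 'I_s.+1 -> 'I_k,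
    posdef (shifted_gram f' (b / 3)) /\ k%:R + potential f' (b / 3) <= (b / 3)^-1.
Proof.
move=> k0 sn b0 pX le_b; have le_b3 : b / 3 <= b by lra.
have [q [t0 q0 tq ext]] := lower_barrier k0 pX le_b3.
set t := potential f (b / 3) in t0 tq ext; set T := potential f b in tq le_b.
have bq0 : 0 <= b * q by rewrite mulr_ge0 // ltW.
have b1 : 0 < b^-1 by rewrite invr_gt0.
have [||f' [pf' lef']] := ext (3 / 2 / b); first by rewrite !divr_gt0.
- have sn1 : s%:R + 1 <= n%:R :> R by rewrite natr1 ler_nat.
  have W : 2 / 3 <= n%:R - s%:R - k%:R * (b / 3) - b / 3 * t.
    have le1 : b * (k%:R + t) <= 1.
      by rewrite mulrC -ler_pdivlMr // div1r; move: le_b tq; lra.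
    by move: le1 sn1; lra.
  apply: (@le_trans _ _ (b^-1)); first by move: le_b tq; lra.
  by have := ler_wpM2l (ltW b1) W; lra.
- exists f'; split=> //.
  have -> : (b / 3)^-1 = 3 * b^-1 by rewrite invfM invrK mulrC.
  by move: lef' tq le_b; rewrite -/t; lra.
Qed.

Lemma greedy_extraction : (0 < k)%N ->
  exists f : 'I_n -> 'I_k, posdef (shifted_gram f (k%:R * 3 ^+ n)^-1).
Proof.
move=> k0.
have k1 : 0 < k%:R :> R by rewrite ltr0n.
suff /(_ n (leqnn n)) [f [pf _]] : forall s, (s <= n)%N -> exists f : 'I_s -> 'I_k,
    posdef (shifted_gram f (k%:R * 3 ^+ s)^-1) /\
    k%:R + potential f (k%:R * 3 ^+ s)^-1 <= k%:R * 3 ^+ s by exists f.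
elim=> [_|s IHs sn].
  exists (fun=> Ordinal k0); split; first exact: posdef_shifted_gram0.
  by rewrite potential0 addr0 expr0 mulr1.
have [f [pf lef]] := IHs (ltnW sn).
have b0 : 0 < (k%:R * 3 ^+ s)^-1 :> R by rewrite invr_gt0 mulr_gt0 ?exprn_gt0.
have [|f' [pf' lef']] := greedy_step k0 sn b0 pf; first by rewrite invrK.
have E : (k%:R * 3 ^+ s)^-1 / 3 = (k%:R * 3 ^+ s.+1)^-1 :> R.
  by rewrite exprSr mulrA [RHS]invfM.
by exists f'; rewrite -E -[X in _ /\ _ <= X]invrK -E.
Qed.

(** The invariant says that potential - (n - s) / b, which is the trace of the
    resolvent at [b] of the n x n matrix having the selected minor as nonzero
    part, is at most - c.  With d = b - b' and W the sum of the Schur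
    complements at [b'], the potential may grow by
      D >= d q + ((n - s) d / b - 1) / b',
    while the cost is k + t + b' q = (n - s - W) / b' + b' q.  So b <= d W is
    enough for cost <= D W, and it follows from the last hypothesis because
    b' (c - k) <= W. *)
Lemma barrier_step s (f : 'I_s -> 'I_k) (b b' c : R) :
  (0 < k)%N -> (s < n)%N -> 0 < b' -> b' < b ->
  posdef (shifted_gram f b) ->
  potential f b + c <= (n%:R - s%:R) / b ->
  b <= b' * ((b - b') * (c - k%:R)) ->
  exists f' : 'I_s.+1 -> 'I_k, posdef (shifted_gram f' b') /\
    potential f' b' + c <= (n%:R - s.+1%:R) / b'.
Proof.
move=> k0 sn b'0 b'b pX leb hc.
have [q [t0 q0 tq ext]] := lower_barrier k0 pX (ltW b'b).
set t := potential f b' in t0 tq ext *; set T := potential f b in tq leb.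
have b0 : 0 < b := lt_trans b'0 b'b.
set r := n%:R - s%:R in leb ext *.
have r0 : 0 < r by rewrite subr_gt0 ltr_nat.
have k1 : 0 < k%:R :> R by rewrite ltr0n.
pose x := b'^-1; pose y := b^-1.
have xE : b' * x = 1 by rewrite divff ?gt_eqF.
have yE : b * y = 1 by rewrite divff ?gt_eqF.
have x0 : 0 < x by rewrite invr_gt0.
have y0 : 0 < y by rewrite invr_gt0.
pose d := b - b'; have d0 : 0 < d by rewrite subr_gt0.
pose W := r - k%:R * b' - b' * t; pose D := (r - 1) * x - c - t.
have xy : x - y = d * x * y.
  by rewrite /d mulrBl mulrBl -mulrA (mulrC x) mulrA yE mul1r xE mul1r.
have le1 : T + c <= r * y by [].
have leD : d * q + (r * d * y - 1) * x <= D.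
  suff : d * q + r * (d * x * y) <= r * x - c - t by rewrite /D; lra.
  by rewrite -xy; move: tq le1; rewrite -/d; lra.
have W1 : b <= d * W.
  have : b' * (c - k%:R) <= W.
    suff : c - k%:R <= W * x.
      by move=> le; rewrite -(ler_pM2r x0) mulrAC xE mul1r.
    have -> : W * x = r * x - (k%:R + t) * (b' * x) by rewrite /W; ring.
    rewrite xE mulr1; have : r * y <= r * x.
      by rewrite ler_pM2l // -subr_ge0 xy !mulr_ge0 ?ltW.
    by move: tq le1; rewrite -/d; nra.
  by move=> le; apply: (le_trans hc); rewrite -/d mulrCA ler_pM2l.
have Wr : W < r by rewrite /W; nra.
have W0 : 0 < W by rewrite -(pmulr_rgt0 _ d0); apply: lt_le_trans W1.
have dyW : 1 <= d * y * W.
  by rewrite mulrAC -yE ler_pM2r.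
have rdy : 1 < r * d * y.
  by apply: le_lt_trans dyW _; rewrite mulrC -mulrA ltr_pM2r // mulr_gt0.
have D0 : 0 < D.
  apply: lt_le_trans leD; rewrite ltr_wpDl ?mulr_ge0 ?(ltW d0) //.
  by rewrite mulr_gt0 // subr_gt0.
have [|f' [pf' lef']] := ext D D0; last first.
  exists f'; split=> //; rewrite -natr1 opprD addrA -/r -/x.
  by move: lef'; rewrite /D; lra.
rewrite -/W; apply: (@le_trans _ _ ((d * q + (r * d * y - 1) * x) * W)); last first.
  by rewrite ler_pM2r.
have E : k%:R + t = (r - W) * x.
  by rewrite /W; transitivity ((k%:R + t) * (b' * x)); [rewrite xE mulr1 | ring].
rewrite E [leRHS]mulrDl [leLHS]addrC; apply: lerD.
  rewrite mulrAC ler_wpM2r //; apply: le_trans W1; exact: ltW.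
by rewrite mulrAC ler_pM2r // mulrBl mul1r lerD2r; move: dyW; nra.
Qed.

(** [barrier_step] iterated with constant step [d] and c = n / b0, for which the
    invariant is an equality at the start. *)
Lemma barrier_extraction (b0 d bT : R) T :
  (0 < k)%N -> (T <= n)%N -> 0 < b0 -> 0 < d -> 0 < bT -> bT <= b0 - T%:R * d ->
  d / bT + 1 <= d * (n%:R / b0 - k%:R) ->
  exists f : 'I_T -> 'I_k, posdef (shifted_gram f (b0 - T%:R * d)).
Proof.
move=> k0 Tn b00 d0 bT0 lebT hd.
suff /(_ T (leqnn T)) [f [pf _]] : forall s, (s <= T)%N -> exists f : 'I_s -> 'I_k,
    posdef (shifted_gram f (b0 - s%:R * d)) /\
    potential f (b0 - s%:R * d) + n%:R / b0 <= (n%:R - s%:R) / (b0 - s%:R * d).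
  by exists f.
elim=> [_|s IHs sT].
  exists (fun=> Ordinal k0); split; first exact: posdef_shifted_gram0.
  by rewrite potential0 add0r mul0r !subr0.
have [f [pf lef]] := IHs (ltnW sT).
have le_b' : bT <= b0 - s.+1%:R * d.
  have : s.+1%:R <= T%:R :> R by rewrite ler_nat.
  by move=> sT'; apply: le_trans lebT _; rewrite lerD2l lerN2 ler_pM2r.
have bE : b0 - s%:R * d = b0 - s.+1%:R * d + d by rewrite -natr1; ring.
apply: (barrier_step k0 (leq_trans sT Tn) _ _ pf lef); first exact: lt_le_trans le_b'.
  by rewrite bE ltrDl.
rewrite bE; set b' := b0 - _ in le_b' *.
have b'0 : 0 < b' by exact: lt_le_trans le_b'.
rewrite (addrC b') addrK -ler_pdivrMl //.
apply: le_trans hd; rewrite mulrDr mulVf ?gt_eqF // lerD2r mulrC.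
by rewrite ler_pM2l // lef_pV2.
Qed.

(** A repeated index makes the difference of two basis vectors a null vector. *)
Lemma posdef_shifted_gram_inj s (f : 'I_s -> 'I_k) b :
  0 <= b -> posdef (shifted_gram f b) -> injective f.
Proof.
move=> b0 [_ pX] x y fxy; apply/eqP/negPn/negP => xy.
pose u : 'rV[K]_s := \row_i ((i == x)%:R - (i == y)%:R).
have u0 : u != 0.
  apply: contraNneq xy => /matrixP/(_ 0 x); rewrite !mxE eqxx.
  by case: eqVneq => // _ /eqP; rewrite subr0 oner_eq0.
have := pX _ u0; rewrite le_gtF //.
have uG : u *m mxsub f f P = 0.
  apply/matrixP => i j; rewrite !mxE.
  under eq_bigr => t _ do rewrite !mxE mulrBl !mulr_natl !mulrb.
  by rewrite sumrB -!big_mkcond !big_pred1_eq fxy subrr.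
rewrite /qform /shifted_gram mulmxBr uG sub0r mul_mx_scalar mulNmx -scalemxAl.
rewrite !mxE oppr_le0 mulr_ge0 ?real_scalar_ge0 // sumr_ge0 // => i _.
by rewrite [X in _ * X]mxE [X in _ * conj X]mxE mul_conj_ge0.
Qed.

Lemma gram_lower_bound s (f : 'I_s -> 'I_k) b (a : 'I_k -> K) :
  0 <= b -> posdef (shifted_gram f b) ->
  b * \sum_(i in [set f t | t in 'I_s]) modulus (a i) ^+ 2 <=
  rpart (\sum_(i in [set f t | t in 'I_s]) \sum_(j in [set f t | t in 'I_s])
           a i * P i j * conj (a j)).
Proof.
move=> b0 pX; have injf := posdef_shifted_gram_inj b0 pX.
have injf' : {in 'I_s &, injective f} by move=> x y _ _; exact: injf.
rewrite !big_imset //=; under [in leRHS]eq_bigr => i _ do rewrite big_imset //=.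
pose u : 'rV[K]_s := \row_t a (f t).
have -> : \sum_(i in 'I_s) \sum_(j in 'I_s) a (f i) * P (f i) (f j) * conj (a (f j))
    = qform (mxsub f f P) u.
  rewrite exchange_big /qform mxE; apply: eq_bigr => j _ /=.
  rewrite !mxE mulr_suml; apply: eq_bigr => i _.
  by rewrite !mxE.
rewrite -[mxsub f f P](subrK b%:K%:M) qformD raddfD /= addrC.
rewrite qform_scalar real_partZ raddf_sum /=.
under eq_bigr => i _ do rewrite sqr_modulus.
rewrite (eq_bigr (fun i => rpart (u 0 i * conj (u 0 i)))); last first.
  by move=> i _; rewrite mxE.
by rewrite lerDl real_part_ge0 // qform_ge0.
Qed.

End Compression.

(** The inverse of the lower bound for the minor: the first term serves the
    dimensions above [N], the second those up to [N]. *)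
Definition extraction_const (eps C : R) : R :=
  let N := Num.bound (64 / eps ^+ 2) in
  16 * C / eps ^+ 2 + C * N%:R * 3 ^+ N.

(** Since k b0 <= n eps / 4, the product d (n / b0 - k) is at least
    (1 + eps / 2) (1 - eps / 4) >= 1 + eps / 8, and T d is at most
    b0 (1 - eps / 2 + (1 + eps / 2) / n).  The condition on [n] makes d / bT,
    of order 1 / (n eps), smaller than eps / 8, and (1 + eps / 2) / n smaller
    than eps / 4. *)
Lemma barrier_parameters (eps C n k : R) (b0 := eps / (4 * C))
    (d := (1 + eps / 2) * b0 / n) (bT := b0 * (eps / 4)) (T : R) :
  0 < eps -> eps < 1 -> 0 < C -> 0 < n -> k <= C * n -> 64 / eps ^+ 2 <= n ->
  T <= (1 - eps) * n + 1 ->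
  [/\ 0 < b0, 0 < d, 0 < bT, bT <= b0 - T * d & d / bT + 1 <= d * (n / b0 - k)].
Proof.
move=> e0 e1 C0 n0 kCn le_n le_T.
have b00 : 0 < b0 by rewrite divr_gt0 ?mulr_gt0.
have d0 : 0 < d by rewrite divr_gt0 // mulr_gt0 // addr_gt0 // divr_gt0.
have e20 : 0 < eps ^+ 2 by rewrite exprn_gt0.
have ne : 64 <= n * eps ^+ 2 by rewrite -ler_pdivrMr.
have n64 : 64 * n^-1 <= eps ^+ 2.
  by rewrite ler_pdivrMr // mulrC.
have x0 : 0 < n^-1 by rewrite invr_gt0.
have nx : n * n^-1 = 1 by rewrite divff ?gt_eqF.
split=> //; first by rewrite mulr_gt0 // divr_gt0.
- have : T * d <= ((1 - eps) * n + 1) * d by rewrite ler_pM2r.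
  have -> : ((1 - eps) * n + 1) * d =
      b0 * ((1 + eps / 2) * ((1 - eps) * (n * n^-1) + n^-1)).
    by rewrite /d; ring.
  rewrite nx /bT => le; rewrite -subr_ge0.
  have : b0 * ((1 + eps / 2) * ((1 - eps) * 1 + n^-1)) <= b0 * (1 - eps / 4).
    by rewrite ler_pM2l //; nra.
  by move: le; lra.
- have -> : d / bT + 1 = (1 + eps / 2) * 4 / eps * n^-1 + 1.
    by rewrite /d /bT; field; rewrite !gt_eqF.
  have -> : d * (n / b0 - k) = (1 + eps / 2) * (1 - k * n^-1 * b0).
    by rewrite /d; field; rewrite !gt_eqF.
  have kb0 : k * n^-1 * b0 <= eps / 4.
    have -> : eps / 4 = C * b0 by rewrite /b0; field; rewrite gt_eqF.
    by rewrite ler_pM2r // ler_pdivrMr.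
  have : (1 + eps / 2) * 4 / eps * n^-1 <= eps / 8.
    rewrite mulrAC ler_pdivrMr //; nra.
  by nra.
Qed.

Lemma exists_nat_approx (x : R) (n : nat) : 0 <= x -> x <= n%:R ->
  exists T : nat, [/\ (T <= n)%N, x <= T%:R & T%:R <= x + 1].
Proof.
move=> x0 xn; have exT : exists m : nat, x <= m%:R by exists n.
case: (ex_minnP exT) => T xT minT; exists T; split=> //; first exact: minT.
case: T xT minT => [|T] xT minT; first by rewrite addr_ge0.
rewrite -natr1 lerD2r; apply: ltW; rewrite ltNge.
by apply/negP => /minT; rewrite ltnn.
Qed.

Theorem well_conditioned_minor (n k : nat) (P : 'M[K]_k) (eps C : R) :
  P^H = P -> P *m P = P -> \tr P = n%:R ->
  (0 < n)%N -> 0 < eps -> eps < 1 -> k%:R <= C * n%:R ->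
  exists s : {set 'I_k}, (1 - eps) * n%:R <= #|s|%:R /\
    forall a : 'I_k -> K,
      \sum_(i in s) modulus (a i) ^+ 2 <=
      extraction_const eps C *
        rpart (\sum_(i in s) \sum_(j in s) a i * P i j * conj (a j)).
Proof.
move=> hP PP trP n0 e0 e1 kCn.
have k0 : (0 < k)%N.
  rewrite lt0n; apply: contraTneq n0 => k0; rewrite lt0n negbK.
  move: trP; rewrite /mxtrace big1 => [/esym/eqP|[i ik] _]; first by rewrite pnatr_eq0.
  by exfalso; move: ik; rewrite k0.
have n1 : 0 < n%:R :> R by rewrite ltr0n.
have k1 : 0 < k%:R :> R by rewrite ltr0n.
have C0 : 0 < C by rewrite -(pmulr_lgt0 _ n1); apply: lt_le_trans kCn.
set L := extraction_const eps C.
have C1 : 0 < 16 * C / eps ^+ 2 by rewrite divr_gt0 ?mulr_gt0 ?exprn_gt0.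
suff [T [f [b [b0 pX le_T bL]]]] : exists T (f : 'I_T -> 'I_k) b,
    [/\ 0 < b, posdef (shifted_gram P f b), (1 - eps) * n%:R <= T%:R & b^-1 <= L].
  exists [set f t | t in 'I_T]; split=> [|a].
    have injf := posdef_shifted_gram_inj (ltW b0) pX.
    by rewrite card_imset ?card_ord.
  have := gram_lower_bound a (ltW b0) pX; set S := (X in b * X); set Q := rpart _.
  move=> le; have S0 : 0 <= S by apply: sumr_ge0 => i _; exact: sqr_ge0.
  have Q0 : 0 <= Q by apply: le_trans le; rewrite mulr_ge0 // ltW.
  by apply: (@le_trans _ _ (b^-1 * Q)); [rewrite ler_pdivlMl | rewrite ler_wpM2r].
rewrite /L /extraction_const; set N := Num.bound _.
(* Up to dimension N the greedy extraction, above it the barrier argument. *)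
have [nN|Nn] := leqP n N.
  have [f pX] := greedy_extraction hP PP trP k0.
  exists n, f, (k%:R * 3 ^+ n)^-1; split=> //.
  - by rewrite invr_gt0 mulr_gt0 ?exprn_gt0.
  - by rewrite ler_piMl ?ler0n // lerBlDr lerDl ltW.
  rewrite invrK; apply: le_trans (_ : C * N%:R * 3 ^+ N <= _); last first.
    by rewrite lerDr ltW.
  apply: ler_pM; rewrite ?ler0n ?exprn_ge0 //; last by rewrite ler_weXn2l ?ler1n.
  by apply: le_trans kCn _; rewrite ler_pM2l // ler_nat.
have le_n : 64 / eps ^+ 2 <= n%:R.
  have c0 : 0 <= 64 / eps ^+ 2 by rewrite divr_ge0 ?exprn_ge0 ?ltW.
  apply: le_trans (ltW (archi_boundP c0)) _.
  by rewrite ler_nat; exact: ltnW.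
have [||T [Tn le_T T_le]] := @exists_nat_approx ((1 - eps) * n%:R) n.
- by rewrite mulr_ge0 ?ler0n // subr_ge0 ltW.
- by rewrite ler_piMl ?ler0n // lerBlDr lerDl ltW.
have [b00 d0 bT0 lebT hd] := barrier_parameters e0 e1 C0 n1 kCn le_n T_le.
have [f pX] := barrier_extraction hP PP trP k0 Tn b00 d0 bT0 lebT hd.
have bT_gt0 := lt_le_trans bT0 lebT.
set b := (X in shifted_gram P f X) in pX *; exists T, f, b; split=> //.
apply: (@le_trans _ _ (16 * C / eps ^+ 2)); last first.
  by rewrite lerDl !mulr_ge0 ?ler0n ?exprn_ge0 // ltW.
rewrite -[leRHS]invrK lef_pV2 ?posrE ?invr_gt0 //; apply: le_trans lebT.
by rewrite le_eqVlt; apply/orP; left; apply/eqP; field; rewrite !gt_eqF.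
Qed.

End Barrier.

(** * The frame operator and the dual frame *)
Section Frame.
Variables (R : realType) (F : scalars).
Local Notation K := (scalar_field R F).
Local Notation conj := (@scalar_conj R F).
Local Notation "M ^H" := (map_mx conj M^T) (at level 8, format "M ^H").
Local Notation "r %:K" := (@real_scalar R F r) (at level 2, format "r %:K").
Local Notation rpart := (@real_part R F).
Variables (H : vectType K) (dot : {dot H for conj}).

Lemma dotC u v : dot u v = conj (dot v u).
Proof. by rewrite hermC expr0 mul1r. Qed.

Lemma dot_ge0 u : 0 <= dot u u.
Proof.
have [->|/(neq0_dnorm_gt0 (s:=dot))/ltW//] := eqVneq u 0.
by rewrite linear0r.
Qed.

Lemma hilbert_norm_ge0 u : 0 <= hilbert_norm dot u.
Proof. exact: sqrtr_ge0. Qed.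

Lemma sqr_hilbert_norm u : hilbert_norm dot u ^+ 2 = rpart (dot u u).
Proof.
have u0 := dot_ge0 u; rewrite /hilbert_norm (modulus_real u0).
by rewrite sqr_sqrtr ?real_part_ge0.
Qed.

Lemma real_part_dotC u v : rpart (dot u v) = rpart (dot v u).
Proof. by rewrite dotC real_part_conj. Qed.

Lemma real_part_dotZl r u v : rpart (dot (r%:K *: u) v) = r * rpart (dot u v).
Proof. by rewrite linearZl_LR real_partZ. Qed.

Lemma sqr_dist_expand (r : R) u v :
  rpart (dot (u - r%:K *: v) (u - r%:K *: v)) =
    rpart (dot u u) - 2 * r * rpart (dot u v) + r ^+ 2 * rpart (dot v v).
Proof.
rewrite linearBl !linearBr !raddfB /= !real_part_dotZl.
rewrite ![rpart (dot _ (r%:K *: v))]real_part_dotC !real_part_dotZl.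
by rewrite (real_part_dotC v u); ring.
Qed.

Lemma sqr_modulus_expand (r : R) (a c : K) :
  modulus (r%:K * a - c) ^+ 2 =
    r ^+ 2 * modulus a ^+ 2 - 2 * r * rpart (a * conj c) + modulus c ^+ 2.
Proof.
rewrite !sqr_modulus rmorphB rmorphM /= conj_real_scalar.
have -> : (r%:K * a - c) * (r%:K * conj a - conj c) =
    r%:K * (r%:K * (a * conj a)) - r%:K * (a * conj c) - r%:K * (c * conj a)
    + c * conj c by ring.
rewrite !raddfD /= !raddfN /= !real_partZ.
have -> : rpart (c * conj a) = rpart (a * conj c).
  by rewrite -real_part_conj rmorphM /= scalar_conjK mulrC.
by ring.
Qed.

Variables (k : nat) (f : 'I_k -> H) (A B : R).
Hypothesis frameP : frame dot f A B.

Definition frame_operator (u : H) : H := \sum_i dot u (f i) *: f i.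

Fact frame_operator_linear : linear frame_operator.
Proof.
move=> a u v; rewrite /frame_operator scaler_sumr -big_split /=.
by apply: eq_bigr => i _; rewrite linearPl /= scalerDl scalerA.
Qed.
HB.instance Definition _ :=
  GRing.isLinear.Build K H H *:%R frame_operator frame_operator_linear.

Lemma dot_frame_operatorl u v :
  dot (frame_operator u) v = \sum_i dot u (f i) * dot (f i) v.
Proof.
by rewrite linear_sumlz; apply: eq_bigr => i _; rewrite linearZl_LR.
Qed.

Lemma frame_operator_selfadjoint u v :
  dot (frame_operator u) v = dot u (frame_operator v).
Proof.
rewrite [RHS]dotC !dot_frame_operatorl rmorph_sum; apply: eq_bigr => i _ /=.
by rewrite rmorphM /= -!dotC mulrC.
Qed.

Lemma frame_operator_energy u :
  rpart (dot (frame_operator u) u) = \sum_i modulus (dot u (f i)) ^+ 2.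
Proof.
rewrite dot_frame_operatorl raddf_sum; apply: eq_bigr => i _ /=.
by rewrite (dotC (f i) u) sqr_modulus.
Qed.

Lemma frame_operator_bounds u :
  A * rpart (dot u u) <= rpart (dot (frame_operator u) u) <= B * rpart (dot u u).
Proof. by have [_ _] := frameP; rewrite frame_operator_energy -sqr_hilbert_norm. Qed.

Lemma frame_bounds_gt0 : 0 < A /\ 0 < B.
Proof. by have [A0 AB _] := frameP; split=> //; exact: lt_le_trans AB. Qed.

(** Expand the sum over [s] of |B a_i - <w, f_i>|^2 >= 0: the cross terms add
    up to |w|^2, and the upper frame bound controls the sum of |<w, f_i>|^2. *)
Lemma synthesis_bound (s : {set 'I_k}) (a : 'I_k -> K) (w := \sum_(i in s) a i *: f i) :
  rpart (dot w w) <= B * \sum_(i in s) modulus (a i) ^+ 2.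
Proof.
have [_ B0] := frame_bounds_gt0.
have : 0 <= \sum_(i in s) modulus (B%:K * a i - dot w (f i)) ^+ 2.
  by apply: sumr_ge0 => i _; exact: sqr_ge0.
under eq_bigr => i _ do rewrite sqr_modulus_expand.
rewrite big_split sumrB -!mulr_sumr /=.
have -> : \sum_(i in s) rpart (a i * conj (dot w (f i))) = rpart (dot w w).
  rewrite {2}/w linear_sumlz raddf_sum; apply: eq_bigr => i _ /=.
  by rewrite linearZl_LR -dotC.
have le : \sum_(i in s) modulus (dot w (f i)) ^+ 2 <= B * rpart (dot w w).
  have /andP[_] := frame_operator_bounds w; rewrite frame_operator_energy.
  apply: le_trans; rewrite [leRHS](bigID [in s]) /= lerDl.
  by apply: sumr_ge0 => i _; exact: sqr_ge0.
move=> ge0; rewrite -(ler_pM2l B0); move: le ge0; lra.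
Qed.

(** Bundled as an endomorphism, for its inverse [frame_endo^-1]. *)
Definition frame_endo : 'End(H) := linfun frame_operator.

Lemma lker_frame_endo : lker frame_endo == 0%VS.
Proof.
have [A0 _] := frame_bounds_gt0.
apply/eqP; apply/eqP; rewrite -subv0; apply/subvP => u.
rewrite memv_ker lfunE memv0 => /eqP /= Fu0.
apply/negPn/negP => /(neq0_dnorm_gt0 (s:=dot)) u0.
have := u0; rewrite -(real_partK (ltW u0)) real_scalar_gt0 => r0.
have /andP[+ _] := frame_operator_bounds u.
by rewrite Fu0 linear0l raddf0 leNgt mulr_gt0.
Qed.

Definition dual_vector i : H := (frame_endo^-1)%VF (f i).
Local Notation g := dual_vector.

Lemma frame_operator_dual i : frame_operator (g i) = f i.
Proof. by have := lker0_lfunVK lker_frame_endo (f i); rewrite lfunE. Qed.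

Lemma frame_expansion u : u = \sum_i dot u (f i) *: g i.
Proof.
rewrite -[LHS](lker0_lfunK lker_frame_endo) lfunE /= /frame_operator linear_sum.
by apply: eq_bigr => i _; rewrite linearZ.
Qed.

(** The Gram matrix of [f] for the inner product <S^-1 u, v>, S being the frame
    operator; [f] is a Parseval frame for it. *)
Definition dual_gram : 'M[K]_k := \matrix_(i, j) dot (g i) (f j).
Local Notation P := dual_gram.

Lemma dual_gram_adj : P^H = P.
Proof.
apply/matrixP => i j; rewrite !mxE -dotC -{1}(frame_operator_dual i).
by rewrite frame_operator_selfadjoint frame_operator_dual.
Qed.

Lemma dual_gram_idem : P *m P = P.
Proof.
apply/matrixP => i l; rewrite !mxE [in RHS](frame_expansion (g i)).
rewrite linear_sumlz; apply: eq_bigr => j _.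
by rewrite linearZl_LR !mxE.
Qed.

(** In a basis e, the coordinate of e_l along itself, computed by
    [frame_expansion], is the sum over j of <e_l, f_j> times the l-th coordinate
    of g_j; summing over l gives the trace. *)
Lemma trace_dual_gram : \tr P = (\dim {:H})%:R.
Proof.
pose e := vbasis {:H}; pose x j l := coord e l (g j).
have fe : free e by exact: basis_free (vbasisP _).
transitivity (\sum_(l < \dim {:H}) \sum_(j < k) dot e`_l (f j) * x j l).
  rewrite exchange_big; apply: eq_bigr => j _; rewrite mxE.
  rewrite [in LHS](coord_vbasis (memvf (g j))) linear_sumlz.
  by apply: eq_bigr => l _; rewrite linearZl_LR mulrC.
have <- : \sum_(l < \dim {:H}) 1 = (\dim {:H})%:R :> K by rewrite sumr_const card_ord.
apply: eq_bigr => l _; have -> : 1 = coord e l e`_l by rewrite coord_free // eqxx.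
rewrite [in RHS](frame_expansion e`_l) linear_sum.
by apply: eq_bigr => j _; rewrite linearZ.
Qed.

(** [synthesis_bound] for the coefficients <g_i, f_j>, whose combination is f_i,
    gives alpha^2 <= |f_i|^2 <= B P_ii; then sum over i. *)
Lemma card_frame_le (alpha : R) : 0 < alpha ->
  (forall i, alpha <= hilbert_norm dot (f i)) ->
  k%:R <= B / alpha ^+ 2 * (\dim {:H})%:R.
Proof.
move=> a0 lea; have [_ B0] := frame_bounds_gt0.
have fP i : alpha ^+ 2 <= B * rpart (P i i).
  apply: (@le_trans _ _ (rpart (dot (f i) (f i)))).
    by rewrite -sqr_hilbert_norm lerXn2r ?nnegrE ?hilbert_norm_ge0 // ltW.
  have := synthesis_bound [set: 'I_k] (fun j => dot (g i) (f j)).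
  rewrite !(eq_bigl xpredT _ (in_setT (T:='I_k))).
  rewrite -/(frame_operator (g i)) -frame_operator_energy frame_operator_dual.
  by rewrite real_part_dotC mxE.
have a20 : 0 < alpha ^+ 2 by rewrite exprn_gt0.
rewrite mulrAC ler_pdivlMr //.
have := ler_sum (index_enum 'I_k) (fun i (_ : true) => fP i).
rewrite sumr_const card_ord -mulr_sumr -raddf_sum -/(mxtrace P) trace_dual_gram.
by rewrite /= real_part_nat mulr_natl.
Qed.

(** With u the preimage of [w] under the frame operator, the form is <u, w>.
    Expand |w - A u|^2 >= 0 and use A |u|^2 <= <u, w>. *)
Lemma dual_form_bound (s : {set 'I_k}) (a : 'I_k -> K) (w := \sum_(i in s) a i *: f i) :
  A * rpart (\sum_(i in s) \sum_(j in s) a i * P i j * conj (a j)) <= rpart (dot w w).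
Proof.
pose u := \sum_(i in s) a i *: g i.
have wE : frame_operator u = w.
  rewrite /u linear_sum; apply: eq_bigr => i _.
  by rewrite linearZ /= frame_operator_dual.
have -> : \sum_(i in s) \sum_(j in s) a i * P i j * conj (a j) = dot u w.
  rewrite /u linear_sumlz; apply: eq_bigr => i _.
  rewrite /w linear_sumr; apply: eq_bigr => j _.
  by rewrite linearZl_LR linearZr_LR mxE /=; ring.
have [A0 _] := frame_bounds_gt0.
have : 0 <= rpart (dot (w - A%:K *: u) (w - A%:K *: u)).
  by rewrite real_part_ge0 // dot_ge0.
have /andP[+ _] := frame_operator_bounds u; rewrite wE sqr_dist_expand.
rewrite (real_part_dotC w u) => le; have := ler_wpM2l (ltW A0) le.
by lra.
Qed.

End Frame.

Lemma extraction_const_ge0 (R : realType) (eps C : R) :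
  0 <= eps -> 0 <= C -> 0 <= extraction_const eps C.
Proof.
move=> e0 C0; rewrite addr_ge0 //; first by rewrite divr_ge0 ?exprn_ge0 ?mulr_ge0.
by rewrite mulr_ge0 ?exprn_ge0 // mulr_ge0.
Qed.

(** * Extraction of a Riesz basis *)
(** The summand 1 makes the constant positive for all values of the arguments;
    the square roots are the upper and the inverse of the lower Riesz bound. *)
Definition riesz_constant (R : realType) (eps A B alpha : R) : R :=
  1 + Num.sqrt B + Num.sqrt (extraction_const eps (B / alpha ^+ 2) / A).

Lemma riesz_constant_gt0 (R : realType) (eps A B alpha : R) :
  0 < riesz_constant eps A B alpha.
Proof. by rewrite ltr_wpDr ?sqrtr_ge0 // ltr_wpDr ?sqrtr_ge0. Qed.

Theorem theorem4p3 (R : realType) :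
  exists g : R -> R -> R -> R -> R -> R,
    (forall v w x y z : R, 0 < g v w x y z) /\
    forall (F : scalars) (n k : nat) (H : vectType (scalar_field R F))
      (dot : {dot H for @scalar_conj R F}) (f : 'I_k -> H)
      (A B alpha beta epsilon : R),
      (0 < n)%N -> (0 < k)%N -> \dim {: H} = n ->
      frame dot f A B ->
      0 < alpha ->
      (forall i : 'I_k, alpha <= hilbert_norm dot (f i) <= beta) ->
      0 < epsilon -> epsilon < 1 ->
      exists s : {set 'I_k},
        (1 - epsilon) * n%:R <= #|s|%:R /\
        riesz_basis_for_span dot s f (g epsilon A B alpha beta).
Proof.
exists (fun eps A B alpha _ => riesz_constant eps A B alpha).
split=> [v w x y _|F n k H dot f A B alpha beta eps n0 _ dimH fr a0 fn e0 e1].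
  exact: riesz_constant_gt0.
have [A0 B0] := frame_bounds_gt0 fr.
have trP := trace_dual_gram fr; rewrite dimH in trP.
have kn : k%:R <= B / alpha ^+ 2 * n%:R.
  by rewrite -dimH; apply: (card_frame_le fr a0) => i; have /andP[] := fn i.
have [s [cs hs]] :=
  well_conditioned_minor (dual_gram_adj fr) (dual_gram_idem fr) trP n0 e0 e1 kn.
exists s; split=> // a; set M := riesz_constant _ _ _ _.
have M0 : 0 < M by exact: riesz_constant_gt0.
set L := extraction_const _ _ in hs.
set S := \sum_(i in s) _; set w := \sum_(i in s) _.
have S0 : 0 <= S by apply: sumr_ge0 => i _; exact: sqr_ge0.
have L0 : 0 <= L.
  by apply: extraction_const_ge0; rewrite ?divr_ge0 ?exprn_ge0 ?ltW.
have normwE : hilbert_norm dot w = Num.sqrt (real_part (dot w w)).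
  by rewrite -sqr_hilbert_norm sqrtr_sqr ger0_norm ?hilbert_norm_ge0.
have ww0 : 0 <= real_part (dot w w) by rewrite -sqr_hilbert_norm sqr_ge0.
rewrite normwE; apply/andP; split.
  rewrite mulrC ler_pdivrMr // mulrC.
  apply: (@le_trans _ _ (Num.sqrt (L / A) * Num.sqrt (real_part (dot w w)))).
    rewrite -sqrtrM ?divr_ge0 ?(ltW A0) // ler_wsqrtr //.
    apply: le_trans (hs a) _; rewrite -mulrA ler_wpM2l // ler_pdivlMl //.
    exact: (dual_form_bound fr).
  rewrite ler_wpM2r ?sqrtr_ge0 // /M /riesz_constant lerDr.
  by rewrite addr_ge0 ?sqrtr_ge0.
apply: (@le_trans _ _ (Num.sqrt B * Num.sqrt S)).
  by rewrite -sqrtrM ?(ltW B0) // ler_wsqrtr // (synthesis_bound fr).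
rewrite ler_wpM2r ?sqrtr_ge0 // /M /riesz_constant -addrA addrCA lerDl.
by rewrite addr_ge0 ?sqrtr_ge0.
Qed.
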